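(* Let $w\in[0,1]$ and $\theta\ge 0$. Let $\rho$ be a probability measure on $(0,+\infty)$ admitting a positive density with respect to the Lebesgue measure, and let $\nu$ be a Lévy measure on $(0,+\infty)$ of a pure-jump subordinator with $M_1=\int_0^{+\infty}z\,\nu(\mathrm{d}z)\in(0,1)$. Then, for any $T>0$, the generalized Riccati equation $$\frac{\partial}{\partial t}B_t(r,\theta)=r\left\{-B_t(r,\theta)+w\int_0^{+\infty}\left(1-e^{-B_t(r,\theta)z}\right)\nu(\mathrm{d}z)+(1-w)\int_{y=0}^{y=+\infty}\int_{z=0}^{z=+\infty}\left(1-e^{-B_t(y,\theta)z}\right)\nu(\mathrm{d}z)\,\rho(\mathrm{d}y)\right\},\quad t>0,\ r>0,$$ subject to the initial condition $B_0(\cdot,\theta)=\theta$, admits a unique nonnegative solution $B\in C_{\mathrm{b},T}$ with $$\|B\|_T\le\frac{\theta}{1-M_1}.$$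
   Context: For $T>0$, $C_{\mathrm{b},T}$ is the Banach space of continuous functions $\varphi:[0,T]\times(0,+\infty)\to\mathbb{R}$ with $\|\varphi\|_T:=\sup_{0\le t\le T}\sup_{r\in(0,+\infty)}|\varphi(t,r)|<+\infty$. A function $B_t(r,\theta)$ is identified with the function $\varphi(t,r)=B_t(r,\theta)$ of $(t,r)$ for fixed $\theta$. Solutions are understood in the mild sense: a solution on $[0,T]$ is a bounded continuous function $\varphi$ satisfying, for all $t\in[0,T]$ and $r>0$, $$\varphi(t,r)=\theta e^{-rt}+\int_0^t e^{-r(t-s)}\,r\left\{w\int_0^{+\infty}\left(1-e^{-\varphi(s,r)z}\right)\nu(\mathrm{d}z)+(1-w)\int_0^{+\infty}\int_0^{+\infty}\left(1-e^{-\varphi(s,u)z}\right)\nu(\mathrm{d}z)\,\rho(\mathrm{d}u)\right\}\mathrm{d}s.$$ Uniqueness is within the class of nonnegative solutions $B\in C_{\mathrm{b},T}$ satisfying $\|B\|_T\le\theta(1-M_1)^{-1}$. *)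

(* Defs.v *)
From HB Require Import structures.
From mathcomp Require Import all_boot all_order all_algebra.
From mathcomp Require Import all_classical all_reals all_analysis.
Set Implicit Arguments.
Unset Strict Implicit.
Unset Printing Implicit Defensive.
Import Order.TTheory GRing.Theory Num.Theory.
Import numFieldNormedType.Exports.
Local Open Scope classical_set_scope.
Local Open Scope ring_scope.

Definition posR {R : realType} : set R := `]0%R, +oo[.

(* Measures on (0,+oo) are represented as Borel measures on R for which the
   complement of (0,+oo) is null. *)
Definition on_positive_reals (R : realType)
    (m : {measure set (measurableTypeR R) -> \bar R}) : Prop :=
  m (~` posR) = 0%E.

Definition has_positive_density (R : realType)
    (m : {measure set (measurableTypeR R) -> \bar R}) : Prop :=
  exists f : R -> R,
    [/\ measurable_fun (posR : set R) f,
        (forall x : R, 0 < x -> 0 < f x)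
      & (forall A : set R, measurable A -> A `<=` posR ->
           m A = (\int[lebesgue_measure]_(x in A) (f x)%:E)%E)].

(* For the jump measure of a subordinator, small jumps are integrable to the
   first power (not only to the second). *)
Definition subordinator_levy_measure (R : realType)
    (nu : {measure set (measurableTypeR R) -> \bar R}) : Prop :=
  on_positive_reals nu /\
  (\int[nu]_(z in posR) (Num.min 1 z)%:E < +oo)%E.

Definition first_moment (R : realType)
    (nu : {measure set (measurableTypeR R) -> \bar R}) : \bar R :=
  (\int[nu]_(z in posR) z%:E)%E.

Definition time_rate_domain (R : realType) (T : R) : set (R * R) :=
  `[0, T] `*` posR.

(* Elements of C_{b,T} are represented by total functions on R * R, of which
   only the values on the domain [0,T] x (0,+oo) are meaningful. *)
Definition normT (R : realType) (T : R) (phi : R * R -> R) : \bar R :=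
  ereal_sup [set `|phi x|%:E | x in time_rate_domain T].

Definition CbT (R : realType) (T : R) (phi : R * R -> R) : Prop :=
  {within time_rate_domain T, continuous phi} /\ (normT T phi < +oo)%E.

Definition laplace_exponent (R : realType)
    (nu : {measure set (measurableTypeR R) -> \bar R}) (b : R) : \bar R :=
  (\int[nu]_(z in posR) (1 - expR (- (b * z)))%:E)%E.

(* The integrals take values in the extended reals, so that the equation
   below, whose left-hand side is finite, has no spurious solution coming
   from a conventional value of a divergent integral. *)
Definition mild_solution (R : realType) (w theta : R)
    (rho nu : {measure set (measurableTypeR R) -> \bar R}) (T : R)
    (phi : R * R -> R) : Prop :=
  forall t r : R, 0 <= t <= T -> 0 < r ->
    ((phi (t, r))%:E =
      (theta * expR (- (r * t)))%:E +
      \int[lebesgue_measure]_(s in `[0%R, t])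
        ((expR (- (r * (t - s))) * r)%:E *
         (w%:E * laplace_exponent nu (phi (s, r)) +
          (1 - w)%:E *
            \int[rho]_(u in posR) laplace_exponent nu (phi (s, u)))))%E.

Definition bounded_nonneg_mild_solution (R : realType) (w theta : R)
    (rho nu : {measure set (measurableTypeR R) -> \bar R}) (T : R)
    (phi : R * R -> R) : Prop :=
  [/\ CbT T phi,
      (forall x : R * R, time_rate_domain T x -> 0 <= phi x),
      mild_solution w theta rho nu T phi
    & (normT T phi <= (theta / (1 - fine (first_moment nu)))%:E)%E].

(* Main.v *)
Require Import Defs.
From HB Require Import structures.
From mathcomp Require Import all_boot all_order all_algebra.
From mathcomp Require Import all_classical all_reals all_analysis.
From mathcomp Require Import measurable_realfun ring lra.
Import Order.TTheory GRing.Theory Num.Theory.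
Import numFieldNormedType.Exports.
Local Open Scope classical_set_scope.
Local Open Scope ring_scope.

(* With psi(b) = \int (1 - exp(-bz)) nu(dz), which is M1-Lipschitz on [0, +oo) and
   vanishes at 0, the right-hand side of the mild equation is an operator which
   contracts the supremum norm by the factor M1, because the kernel
   r exp(-r(t - s)) has mass at most 1 on [0, t] whatever t and r are.  It maps
   functions with values in [0, K] to such functions for K = theta / (1 - M1),
   since theta + M1 K = K.  Hence the Picard iterates from 0 converge
   uniformly to a fixpoint, and two fixpoints differ by at most M1^n K for every n. *)

Set Implicit Arguments.
Unset Strict Implicit.
Unset Printing Implicit Defensive.

(** * Lipschitz bound for the Laplace exponent of [nu] *)

Section laplace_exponent.
Context (R : realType) (nu : {measure set (measurableTypeR R) -> \bar R}).
Hypothesis nu_fin : (first_moment nu < +oo)%E.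

Lemma measurable_posR : measurable (posR : set (measurableTypeR R)).
Proof. exact: measurable_itv. Qed.

Lemma posRE (x : R) : posR x = (0 < x) :> Prop.
Proof. by rewrite /posR /= in_itv /= andbT. Qed.

Lemma integrable_id_posR : nu.-integrable posR (EFin \o (fun z : R => z)).
Proof.
apply/integrableP; split; first exact/measurable_EFinP/measurable_funTS.
under eq_integral => z; first rewrite inE posRE => z0.
  by rewrite gee0_abs ?lee_fin ?ltW //; over.
exact: nu_fin.
Qed.

(** For b <= c the difference is exp(-b) (1 - exp(-(c - b))); the first factor is at most 1 and the
    second at most c - b, since 1 + x <= exp x. *)
Lemma expRN_dist (b c : R) : 0 <= b -> 0 <= c ->
  `|expR (- b) - expR (- c)| <= `|b - c|.
Proof.
wlog bc : b c / b <= c => [H b0 c0|b0 c0].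
  have [|/ltW] := leP b c => bc; first exact: H.
  by rewrite distrC (distrC b); exact: H.
rewrite ger0_norm; last by rewrite subr_ge0 ler_expR lerN2.
rewrite ler0_norm ?subr_le0 // opprB.
have -> : - c = - b - (c - b) by ring.
rewrite expRD; have := expR_ge1Dx (- (c - b)).
have : expR (- b) <= 1 by rewrite -expR0 ler_expR oppr_le0.
have := expR_gt0 (- b); have cb : 0 <= c - b by rewrite subr_ge0.
move: (expR (- b)) (expR _) (c - b) cb => x y d; nra.
Qed.

(** The integrand is dominated by b z, which the finite first moment makes integrable. *)
Lemma integrable_laplace (b : R) : 0 <= b ->
  nu.-integrable posR (EFin \o (fun z : R => 1 - expR (- (b * z)))).
Proof.
move=> b0.
apply: (@le_integrable _ _ _ nu posR measurable_posR _ (fun z => b%:E * z%:E)%E).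
- apply/measurable_EFinP/measurable_funB => //.
  apply: measurableT_comp => //; apply: measurable_funTS.
  by apply: measurableT_comp => //; exact: measurable_funM.
- move=> z; rewrite posRE => z0 /=; rewrite lee_fin.
  have bz0 : 0 <= b * z by rewrite mulr_ge0 // ltW.
  have := @expRN_dist 0 (b * z) (lexx _) bz0.
  by rewrite oppr0 expR0 sub0r normrN.
- apply: integrableZl => //; first exact: measurable_posR.
  exact: integrable_id_posR.
Qed.

(* Truncating at 0 makes the Lipschitz bound global: for b < 0 the integral may
   diverge. *)
Definition psi (b : R) : R := fine (laplace_exponent nu (Num.max 0 b)).

Lemma laplace_exponentE (b : R) : 0 <= b ->
  laplace_exponent nu b = (psi b)%:E.
Proof.
move=> b0; rewrite /psi max_r // fineK // /laplace_exponent.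
apply: integrable_fin_num; first exact: measurable_posR.
exact: integrable_laplace.
Qed.

Lemma psi_ge0 (b : R) : 0 <= psi b.
Proof.
apply/fine_ge0/integral_ge0 => z; rewrite posRE => z0.
rewrite lee_fin subr_ge0 -expR0 ler_expR oppr_le0 mulr_ge0 ?(ltW z0) //.
by rewrite le_max lexx.
Qed.

Lemma psi0 : psi 0 = 0.
Proof.
rewrite /psi maxxx /laplace_exponent integral0_eq // => z _.
by rewrite mul0r oppr0 expR0 subrr.
Qed.

(** Integrating |exp(-bz) - exp(-cz)| <= z |b - c| against [nu] brings out the first moment. *)
Lemma psi_lipschitz (b c : R) :
  `|psi b - psi c| <= fine (first_moment nu) * `|b - c|.
Proof.
(* Truncation at 0 leaves [psi] unchanged and does not increase distances, so nonnegative arguments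
   suffice. *)
wlog : b c / 0 <= b /\ 0 <= c => [H|[b0 c0]].
  have psimax x : psi x = psi (Num.max 0 x) by rewrite /psi maxA maxxx.
  rewrite (psimax b) (psimax c) (le_trans (H _ _ _)) //; first by rewrite !le_max lexx.
  apply: ler_wpM2l.
    by apply/fine_ge0/integral_ge0 => z; rewrite posRE lee_fin; exact: ltW.
  have := ler_norm (b - c); have := ler_norm (c - b); rewrite (distrC c) => hc hb.
  by apply/ler_normlP; case: (leP 0 b); case: (leP 0 c) => ? ?; split; lra.
rewrite /psi !max_r // -[fine (laplace_exponent _ b)]/(Rintegral nu posR _).
rewrite -[fine (laplace_exponent _ c)]/(Rintegral nu posR _).
have mp := measurable_posR; have ib := integrable_laplace b0.
have ic := integrable_laplace c0.
rewrite -RintegralB //; apply: le_trans (le_normr_Rintegral mp _) _.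
  exact: (integrableB mp ib ic).
rewrite -[fine (first_moment _)]/(Rintegral nu posR (fun z => z)) -RintegralZr //;
  last exact: integrable_id_posR.
apply: le_Rintegral => //.
- exact: (integrable_abse (integrableB mp ib ic)).
- exact: (integrableZr mp _ integrable_id_posR).
move=> z; rewrite posRE => z0.
have -> : 1 - expR (- (b * z)) - (1 - expR (- (c * z))) =
  expR (- (c * z)) - expR (- (b * z)) by ring.
rewrite (le_trans (@expRN_dist _ _ _ _)) ?mulr_ge0 ?(ltW z0) //.
by rewrite -mulrBl normrM (gtr0_norm z0) distrC mulrC.
Qed.

End laplace_exponent.

(** * Integration in time against the exponential kernel *)

Section exponential_kernel.
Context (R : realType).
Notation mu := (@lebesgue_measure R).
Implicit Types (r t a b C : R) (h : R -> R).

Definition kernel r t s : R := expR (- (r * (t - s))) * r.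

Lemma kernel_ge0 r t s : 0 <= r -> 0 <= kernel r t s.
Proof. by move=> r0; rewrite mulr_ge0 ?expR_ge0. Qed.

Lemma continuous_kernel r t : continuous (kernel r t).
Proof.
move=> s; apply: cvgMr_tmp.
apply: (continuous_comp (f := fun s => - (r * (t - s)))); last exact: continuous_expR.
by apply: cvgN; apply: cvgMl_tmp; apply: cvgB; [exact: cvg_cst|exact: cvg_id].
Qed.

Lemma continuous_integrable_itv h a b : continuous h ->
  mu.-integrable `[a, b] (EFin \o h).
Proof.
move=> ch; apply: continuous_compact_integrable; first exact: segment_compact.
exact: continuous_subspaceT.
Qed.

Lemma kernel_integrable r t a b h : continuous h ->
  mu.-integrable `[a, b] (EFin \o (fun s => kernel r t s * h s)).
Proof.
move=> ch; apply: continuous_integrable_itv => s; apply: cvgM; last exact: ch.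
exact: continuous_kernel.
Qed.

(** The function s |-> exp(-r(t - s)) is an antiderivative of the kernel. On [0, t] the mass is thus
    1 - exp(-rt). *)
Lemma kernel_mass r t a b : a <= b ->
  \int[mu]_(s in `[a, b]) kernel r t s =
  expR (- (r * (t - b))) - expR (- (r * (t - a))).
Proof.
rewrite le_eqVlt => /predU1P[->|ab].
  by rewrite set_itv1 Rintegral_set1 subrr.
pose F s := expR (- (r * (t - s))).
have dF (s : R) : is_derive s (1 : R) F (kernel r t s).
  rewrite /F; apply: is_derive_eq.
  by rewrite /kernel add0r mul1r scalerN opprK [_ *: _]mulr1.
rewrite /Rintegral (@continuous_FTC2 _ _ F) //.
- by apply: continuous_subspaceT; exact: continuous_kernel.
- have cF s : {for s, continuous F}.
    by apply/differentiable_continuous/derivable1_diffP; apply: ex_derive.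
  split; first by move=> s _; exact: ex_derive.
  + exact/cvg_at_right_filter/cF.
  + exact/cvg_at_left_filter/cF.
- by move=> s _; rewrite derive1E; exact: derive_val.
Qed.

Definition kernel_int r t a b h : R :=
  \int[mu]_(s in `[a, b]) (kernel r t s * h s).

Lemma kernel_int_ge0 r t a b h : 0 <= r -> {in `[a, b], forall s, 0 <= h s} ->
  0 <= kernel_int r t a b h.
Proof.
move=> r0 h0; apply: Rintegral_ge0 => s sab.
by rewrite mulr_ge0 ?kernel_ge0 // h0.
Qed.

Lemma kernel_int_le r t a b C h : 0 <= r -> a <= b -> continuous h ->
    {in `[a, b], forall s, h s <= C} ->
  kernel_int r t a b h <=
    C * (expR (- (r * (t - b))) - expR (- (r * (t - a)))).
Proof.
move=> r0 ab ch hC; rewrite -kernel_mass // -RintegralZl //; last first.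
  by apply: continuous_integrable_itv; exact: continuous_kernel.
apply: le_Rintegral => //; first exact: kernel_integrable.
  apply: continuous_integrable_itv => s; apply: cvgMl_tmp.
  exact: continuous_kernel.
by move=> s sab; rewrite mulrC ler_wpM2r ?kernel_ge0 // hC.
Qed.

(** The mass 1 - exp(-rt) of the kernel on [0, t] is at most 1, so no factor depending on t or r
    appears. *)
Lemma kernel_int_dist r t C h1 h2 : 0 <= r -> 0 <= t -> 0 <= C ->
    continuous h1 -> continuous h2 ->
    {in `[0, t], forall s, `|h1 s - h2 s| <= C} ->
  `|kernel_int r t 0 t h1 - kernel_int r t 0 t h2| <= C.
Proof.
move=> r0 t0 C0 c1 c2 hC; rewrite /kernel_int -RintegralB //; try exact: kernel_integrable.
under eq_Rintegral do rewrite -mulrBr.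
have ch : continuous (fun s => h1 s - h2 s).
  by move=> s; apply: cvgB; [exact: c1|exact: c2].
have cah : continuous (fun s => `|h1 s - h2 s|).
  by move=> s; apply: cvg_norm; exact: ch.
apply: le_trans (le_normr_Rintegral _ _) _ => //; first exact: kernel_integrable.
under eq_Rintegral do rewrite normrM (ger0_norm (kernel_ge0 _ _ r0)).
apply: le_trans (kernel_int_le _ r0 t0 cah hC) _.
rewrite ler_piMr // subrr mulr0 oppr0 expR0.
by rewrite lerBlDr lerDl expR_ge0.
Qed.

(* Over [0, t], the integral for t' is the one for t times exp(-r(t' - t)), and
   the remaining mass of the kernel is 1 - exp(-r(t' - t)) <= r(t' - t). *)
Lemma kernel_int_lipschitz r t t' C h : 0 <= r -> 0 <= t -> t <= t' ->
    continuous h -> (forall s, 0 <= h s <= C) ->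
  `|kernel_int r t' 0 t' h - kernel_int r t 0 t h| <= C * (r * (t' - t)).
Proof.
move=> r0 t0 tt' ch hC.
have h0 s : 0 <= h s by case/andP: (hC s).
have hleC s : h s <= C by case/andP: (hC s).
have C0 : 0 <= C := le_trans (h0 0) (hleC 0).
set d := expR (- (r * (t' - t))).
have d1 : d <= 1 by rewrite -expR0 ler_expR oppr_le0 mulr_ge0 // subr_ge0.
have rd : 1 - d <= r * (t' - t).
  by have := expR_ge1Dx (- (r * (t' - t))); rewrite -/d; lra.
have -> : kernel_int r t' 0 t' h = d * kernel_int r t 0 t h + kernel_int r t' t t' h.
  rewrite /kernel_int -RintegralZl //; last exact: kernel_integrable.
  rewrite -[X in _ = _ + X]Rintegral_itv_obnd_cbnd; last first.
    by apply: integrableS (kernel_integrable r t' t t' ch) => //; exact: subset_itv_oc_cc.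
  rewrite -(@Rintegral_itvB _ (fun s => kernel r t' s * h s) (BLeft 0) (BRight t') t) ?bnd_simp //;
    last exact: kernel_integrable.
  rewrite addrC; under [X in _ = _ - _ + X]eq_Rintegral => s _.
    rewrite mulrA (_ : d * kernel r t s = kernel r t' s); last first.
      by rewrite /kernel mulrA -expRD; congr (expR _ * _); ring.
    over.
  by rewrite subrK.
have D0 : 0 <= kernel_int r t 0 t h by exact: kernel_int_ge0.
have D1 : kernel_int r t 0 t h <= C.
  apply: le_trans (kernel_int_le (C := C) _ _ _ _ _) _ => //.
  by rewrite ler_piMr // subrr mulr0 oppr0 expR0 lerBlDr lerDl expR_ge0.
have I0 : 0 <= kernel_int r t' t t' h by exact: kernel_int_ge0.
have I1 : kernel_int r t' t t' h <= C * (1 - d).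
  apply: le_trans (kernel_int_le (C := C) _ _ _ _ _) _ => //.
  by rewrite subrr mulr0 oppr0 expR0.
have CC : C * (1 - d) <= C * (r * (t' - t)) by rewrite ler_wpM2l.
move: (kernel_int r t 0 t h) (kernel_int r t' t t' h) D0 D1 I0 I1 => D I D0 D1 I0 I1.
(* The difference d D + I - D equals I - (1 - d) D, and both terms lie in [0, C (1 - d)]. *)
have : 0 <= (1 - d) * D by rewrite mulr_ge0 // subr_ge0.
have : (1 - d) * D <= (1 - d) * C by rewrite ler_wpM2l // subr_ge0.
by move=> ? ?; rewrite ler_norml; apply/andP; split; lra.
Qed.

(** Dominated convergence on the window r0/2 < r < 2 r0: there r stays positive and, for s <= t, the
    kernel is at most r, so the integrand is bounded by 2 r0 C. *)
Lemma kernel_int_continuous_rate (g : R -> R -> R) t C r0 : 0 < r0 -> 0 <= t ->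
    (forall r, 0 < r -> continuous (g^~ r)) ->
    (forall s r, 0 < r -> {for r, continuous (g s)}) ->
    (forall s r, 0 < r -> 0 <= g s r <= C) ->
  {for r0, continuous (fun r => kernel_int r t 0 t (g^~ r))}.
Proof.
move=> r00 t0 cg1 cg2 gC.
apply: (@continuity_under_integral R _ _ mu (fun r s => kernel r t s * g s r) `[0, t]
  _ (r0 / 2) (2 * r0) _ _ (cst (2 * r0 * C))).
- exact: measurable_itv.
- move=> r /=; rewrite in_itv /= => /andP[rl _].
  by apply: kernel_integrable; apply: cg1; lra.
- apply: aeW => s _ r; rewrite inE /= in_itv /= => /andP[rl _].
  have rp : 0 < r by lra.
  apply: cvgM; last exact: cg2.
  apply: cvgM; last exact: cvg_id.
  apply: (continuous_comp (f := fun r => - (r * (t - s)))); last exact: continuous_expR.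
  by apply: cvgN; apply: cvgMr_tmp; exact: cvg_id.
- by apply: continuous_integrable_itv => s; exact: cvg_cst.
- move=> r /=; rewrite in_itv /= => /andP[rl ru]; apply: aeW => s.
  rewrite /= in_itv /= => /andP[s0 st].
  have rp : 0 < r by lra.
  have /andP[g0 gle] := gC s r rp.
  rewrite ger0_norm; last by rewrite mulr_ge0 // kernel_ge0 // ltW.
  apply: ler_pM => //; first by rewrite kernel_ge0 // ltW.
  rewrite /kernel -[leRHS]mul1r ler_pM ?expR_ge0 ?(ltW rp) ?(ltW ru) //.
  by rewrite -expR0 ler_expR oppr_le0 mulr_ge0 ?subr_ge0 // ltW.
- by rewrite inE /= in_itv /=; apply/andP; split; lra.
Qed.

End exponential_kernel.

(** The three-epsilon argument at one point. Closeness is asked only near [x], because the estimates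
    in the rate hold only for r > 0. *)
Lemma uniform_limit_continuous_at (R : realType) (X : topologicalType)
    (f : X -> R) (x : X) :
    (forall e, 0 < e -> exists g : X -> R,
      {for x, continuous g} /\ \forall y \near x, `|f y - g y| <= e) ->
  {for x, continuous f}.
Proof.
move=> H; apply/cvgrPdist_le => e e0.
have e3 : 0 < e / 3 by rewrite divr_gt0.
have [g [cg fg]] := H _ e3.
have fgx := nbhs_singleton fg.
move/cvgrPdist_le : cg => /(_ _ e3) cg.
near=> y.
have h1 : `|f y - g y| <= e / 3 by near: y.
have h2 : `|g x - g y| <= e / 3 by near: y.
have -> : f x - f y = (f x - g x) + (g x - g y) + (g y - f y) by ring.
apply: le_trans (ler_normD _ _) _; rewrite [X in _ + X]distrC.
by have := ler_normD (f x - g x) (g x - g y); lra.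
Unshelve. all: by end_near. Qed.

(** * The Riccati operator: invariance, contraction and regularity *)

Section riccati_operator.
Context (R : realType) (w theta M K T : R).
Context (rho : probability (measurableTypeR R) R) (Psi : R -> R).
Hypothesis w01 : 0 <= w <= 1.
Hypothesis theta0 : 0 <= theta.
Hypothesis M01 : 0 <= M < 1.
Hypothesis thetaK : theta + M * K = K.
Hypothesis T0 : 0 <= T.
Hypothesis Psi_ge0 : forall b, 0 <= Psi b.
Hypothesis Psi0 : Psi 0 = 0.
Hypothesis Psi_lip : forall b c, `|Psi b - Psi c| <= M * `|b - c|.
Implicit Types (f g : R -> R -> R) (s t r b c d C : R).

(* Constant extension in time of functions on [0, T] to the whole line, so that
   continuity in time need not be relativized. *)
Definition clamp t : R := Num.max 0 (Num.min t T).

Lemma clamp_bounds t : 0 <= clamp t <= T.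
Proof. by rewrite /clamp le_max lexx ge_max T0 ge_min lexx orbT. Qed.

Lemma clamp_id t : 0 <= t <= T -> clamp t = t.
Proof. by move=> /andP[t0 tT]; rewrite /clamp min_l // max_r. Qed.

Lemma clamp_dist t s : `|clamp t - clamp s| <= `|t - s|.
Proof.
have := ler_norm (t - s); have := ler_norm (s - t); rewrite (distrC s) => h1 h2.
apply/ler_normlP; rewrite /clamp.
case: (leP t T); case: (leP s T) => ? ?; case: (leP 0 t); case: (leP 0 s) => ? ?;
  by rewrite ?(max_r T0); have := T0; split; lra.
Qed.

Lemma continuous_clamp : continuous clamp.
Proof.
move=> t; apply/cvgrPdist_le => e e0; near=> s.
apply: le_trans (clamp_dist _ _) _.
by near: s; exact: (@cvgr_dist_le _ _ _ _ _ (fun s => s) t cvg_id).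
Unshelve. all: by end_near. Qed.

Lemma M_ge0 : 0 <= M. Proof. by case/andP: M01. Qed.
(** As M < 1, the relation theta + M K = K forces K = theta / (1 - M). *)
Lemma K_ge0 : 0 <= K.
Proof.
have /andP[_ M1] := M01; have -> : K = theta / (1 - M).
  have -> : theta = K * (1 - M) by rewrite mulrBr mulr1 (mulrC K) -[X in X - _]thetaK addrK.
  by rewrite mulfK // subr_eq0 gt_eqF.
by rewrite divr_ge0 // subr_ge0 ltW.
Qed.

Lemma Psi_le b : 0 <= b <= K -> Psi b <= M * K.
Proof.
move=> /andP[b0 bK]; have := Psi_lip b 0; rewrite Psi0 !subr0 !ger0_norm //.
by move/le_trans; apply; rewrite ler_wpM2l // M_ge0.
Qed.

Lemma continuous_Psi : continuous Psi.
Proof.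
move=> b; apply/cvgrPdist_le => e e0; near=> c.
apply: le_trans (Psi_lip _ _) _.
have : `|b - c| <= e.
  by near: c; exact: (@cvgr_dist_le _ _ _ _ _ (fun s => s) b cvg_id).
have /andP[_ /ltW M1] := M01.
by apply: le_trans; rewrite ler_piMl.
Unshelve. all: by end_near. Qed.

(* Separate continuity is enough for all the integrals involved, and it is stable
   under uniform limits and under the operator; it is upgraded to joint continuity
   only for fixpoints. *)
Definition admissible f := [/\ forall t r, 0 < r -> 0 <= f t r <= K,
  forall r, 0 < r -> continuous (f^~ r) &
  forall t r, 0 < r -> {for r, continuous (f t)}].

Definition mean_Psi f s : R := \int[rho]_(u in posR) Psi (f s u).

Lemma rho_integrable (h : R -> R) C : measurable_fun (posR : set R) h ->
    {in posR, forall u, `|h u| <= C} -> rho.-integrable posR (EFin \o h).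
Proof.
move=> mh hC; apply: measurable_bounded_integrable => //.
- exact: measurable_posR.
- by rewrite (le_lt_trans (probability_le1 _ _)) ?ltry //; exact: measurable_posR.
- exists C; split; first exact: num_real.
  by move=> C' CC' u pu; apply: le_trans (ltW CC'); apply: hC; rewrite inE.
Qed.

(** Averaging against a measure of mass at most 1 does not enlarge a uniform bound. *)
Lemma rho_Rintegral_le (h : R -> R) C : measurable_fun (posR : set R) h ->
    0 <= C -> {in posR, forall u, `|h u| <= C} ->
  `|\int[rho]_(u in posR) h u| <= C.
Proof.
move=> mh C0 hC; have mp := @measurable_posR R.
have ih := rho_integrable mh hC.
apply: le_trans (le_normr_Rintegral mp ih) _.
have : \int[rho]_(u in posR) `|h u| <= \int[rho]_(u in posR) C.
  apply: le_Rintegral => //; first exact: integrable_abse ih.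
    by apply: (rho_integrable (C := C)) => // u _; rewrite ger0_norm.
  by move=> u pu; apply: hC; rewrite inE.
move/le_trans; apply; rewrite Rintegral_cst // ler_piMr //.
have p1 : (rho posR <= 1)%E by exact: probability_le1.
by rewrite -lee_fin fineK // ge0_fin_numE // (le_lt_trans p1) // ltry.
Qed.

(** Continuity in the rate on the open half-line gives measurability. *)
Lemma measurable_Psi f s : admissible f ->
  measurable_fun (posR : set R) (fun u => Psi (f s u)).
Proof.
move=> [_ _ cf]; apply: open_continuous_measurable_fun; first exact: interval_open.
move=> u; rewrite inE posRE => u0; apply: (continuous_comp (f := f s)); first exact: cf.
exact: continuous_Psi.
Qed.

Lemma Psi_bounds f s u : admissible f -> 0 < u -> `|Psi (f s u)| <= M * K.
Proof. by move=> [bf _ _] u0; rewrite ger0_norm // Psi_le // bf. Qed.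

Lemma integrable_Psi f s : admissible f ->
  rho.-integrable posR (EFin \o (fun u => Psi (f s u))).
Proof.
move=> af; apply: (rho_integrable (C := M * K)); first exact: measurable_Psi.
by move=> u; rewrite inE posRE => u0; exact: Psi_bounds.
Qed.

Lemma mean_Psi_bounds f s : admissible f -> 0 <= mean_Psi f s <= M * K.
Proof.
move=> af; apply/andP; split; first by apply: Rintegral_ge0.
apply: le_trans (ler_norm _) _; apply: rho_Rintegral_le.
- exact: measurable_Psi.
- by rewrite mulr_ge0 ?M_ge0 ?K_ge0.
- by move=> u; rewrite inE posRE => u0; exact: Psi_bounds.
Qed.

Lemma mean_Psi_dist f g s d : admissible f -> admissible g -> 0 <= d ->
    (forall u, 0 < u -> `|f s u - g s u| <= d) ->
  `|mean_Psi f s - mean_Psi g s| <= M * d.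
Proof.
move=> af ag d0 fg; rewrite /mean_Psi -RintegralB; last 3 first.
- exact: measurable_posR.
- exact: integrable_Psi.
- exact: integrable_Psi.
apply: rho_Rintegral_le.
- by apply: measurable_funB; exact: measurable_Psi.
- by rewrite mulr_ge0 ?M_ge0.
- move=> u; rewrite inE posRE => u0; apply: le_trans (Psi_lip _ _) _.
  by rewrite ler_wpM2l ?M_ge0 // fg.
Qed.

(** Dominated convergence: [Psi (f s u)] is continuous in s for each u > 0 and bounded by the
    constant M K, which is [rho]-integrable. *)
Lemma continuous_mean_Psi f : admissible f -> continuous (mean_Psi f).
Proof.
move=> af s; apply: (@continuity_under_integral R _ _ rho (fun s u => Psi (f s u))
  posR _ (s - 1) (s + 1) _ _ (cst (M * K))).
- exact: measurable_posR.
- by move=> t _; exact: integrable_Psi.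
- apply: aeW => u; rewrite posRE => u0 t _.
  apply: (continuous_comp (f := f^~ u)); last exact: continuous_Psi.
  by have [_ cf _] := af; exact: cf.
- apply: (rho_integrable (C := M * K)) => // u _.
  by rewrite ger0_norm // mulr_ge0 ?M_ge0 ?K_ge0.
- by move=> t _; apply: aeW => u; rewrite posRE; exact: Psi_bounds.
- by rewrite inE /= in_itv /=; apply/andP; split; lra.
Qed.

(** The bracket of the mild equation. Being a convex combination, it inherits the bounds and the
    Lipschitz constant shared by its two terms. *)
Definition source f s r : R := w * Psi (f s r) + (1 - w) * mean_Psi f s.

Lemma source_bounds f s r : admissible f -> 0 < r -> 0 <= source f s r <= M * K.
Proof.
move=> af r0; have /andP[w0 w1] := w01; rewrite /source.
have /andP[m0 mK] := mean_Psi_bounds s af.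
have p0 := Psi_ge0 (f s r).
have pK : Psi (f s r) <= M * K by have [bf _ _] := af; exact/Psi_le/bf.
by move: (Psi (f s r)) (mean_Psi f s) (M * K) p0 pK m0 mK => p m C; nra.
Qed.

Lemma continuous_source f r : admissible f -> 0 < r -> continuous (source f ^~ r).
Proof.
move=> af r0 s; apply: cvgD; apply: cvgMl_tmp; last exact: continuous_mean_Psi.
apply: (continuous_comp (f := f^~ r)); last exact: continuous_Psi.
by have [_ cf _] := af; exact: cf.
Qed.

Lemma continuous_source_rate f s r : admissible f -> 0 < r ->
  {for r, continuous (source f s)}.
Proof.
move=> af r0; apply: cvgD; apply: cvgMl_tmp; last exact: cvg_cst.
apply: (continuous_comp (f := f s)); last exact: continuous_Psi.
by have [_ _ cf] := af; exact: cf.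
Qed.

Lemma source_dist f g s r d : admissible f -> admissible g -> 0 <= d ->
    (forall u, 0 < u -> `|f s u - g s u| <= d) -> 0 < r ->
  `|source f s r - source g s r| <= M * d.
Proof.
move=> af ag d0 fg r0; have /andP[w0 w1] := w01; rewrite /source.
have pd : `|Psi (f s r) - Psi (g s r)| <= M * d.
  by apply: le_trans (Psi_lip _ _) _; rewrite ler_wpM2l ?M_ge0 ?fg.
have md := mean_Psi_dist af ag d0 fg.
have -> : w * Psi (f s r) + (1 - w) * mean_Psi f s -
    (w * Psi (g s r) + (1 - w) * mean_Psi g s) =
  w * (Psi (f s r) - Psi (g s r)) + (1 - w) * (mean_Psi f s - mean_Psi g s).
  by ring.
apply: le_trans (ler_normD _ _) _; rewrite !normrM (ger0_norm w0).
rewrite (@ger0_norm _ (1 - w)) ?subr_ge0 //.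
by move: `|_| `|_| pd md => x y; nra.
Qed.

(** The right-hand side of the mild equation, extended constantly in time outside [0, T]. *)
Definition riccati f t r : R := theta * expR (- (r * clamp t)) +
  kernel_int r (clamp t) 0 (clamp t) (source f ^~ r).

(** The initial terms cancel, the sources differ by at most M d, and the kernel does not enlarge
    this. *)
Lemma riccati_dist f g d : admissible f -> admissible g -> 0 <= d ->
    (forall t r, 0 < r -> `|f t r - g t r| <= d) ->
  forall t r, 0 < r -> `|riccati f t r - riccati g t r| <= M * d.
Proof.
move=> af ag d0 fg t r r0; rewrite /riccati opprD addrACA subrr add0r.
have /andP[t0 _] := clamp_bounds t.
apply: kernel_int_dist; rewrite ?mulr_ge0 ?M_ge0 ?(ltW r0) //.
- exact: continuous_source.
- exact: continuous_source.
- by move=> s _; apply: source_dist => // u; exact: fg.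
Qed.

(** The initial term has Lipschitz constant theta r and the integral M K r; they add up to K r. *)
Lemma riccati_lipschitz f t s r : admissible f -> 0 < r ->
  `|riccati f t r - riccati f s r| <= K * r * `|t - s|.
Proof.
move=> af r0.
(* Since [clamp] does not increase distances, ordered nonnegative times suffice. *)
suff H a b : 0 <= a -> a <= b ->
  `|theta * expR (- (r * b)) + kernel_int r b 0 b (source f ^~ r) -
   (theta * expR (- (r * a)) + kernel_int r a 0 a (source f ^~ r))| <=
   K * r * (b - a).
  have /andP[t0 _] := clamp_bounds t; have /andP[s0 _] := clamp_bounds s.
  apply: le_trans (ler_wpM2l _ (clamp_dist t s)).
    have [st|/ltW ts] := leP (clamp s) (clamp t).
      by rewrite [in leRHS]ger0_norm ?subr_ge0 // H.
    by rewrite distrC (distrC (clamp t)) [in leRHS]ger0_norm ?subr_ge0 // H.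
  by rewrite mulr_ge0 ?K_ge0 // ltW.
move=> a0 ab; rewrite opprD addrACA -mulrBr.
apply: le_trans (ler_normD _ _) _.
have -> : K * r * (b - a) = theta * (r * (b - a)) + M * K * (r * (b - a)).
  by rewrite -[in LHS]thetaK; ring.
apply: lerD; last first.
  apply: kernel_int_lipschitz => //; first exact: ltW.
    exact: continuous_source.
  by move=> u; exact: source_bounds.
rewrite normrM (ger0_norm theta0) ler_wpM2l //.
apply: le_trans (expRN_dist _ _) _; rewrite ?mulr_ge0 ?(ltW r0) //.
  exact: le_trans ab.
by rewrite -mulrBr ger0_norm // mulr_ge0 ?subr_ge0 // ltW.
Qed.

(** With e = exp(-rt) at the clamped time t, the value is at most theta e + M K (1 - e) <= theta + M
    K = K. *)
Lemma riccati_bounds f t r : admissible f -> 0 < r -> 0 <= riccati f t r <= K.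
Proof.
move=> af r0; have /andP[t0 _] := clamp_bounds t; rewrite /riccati.
have k0 : 0 <= kernel_int r (clamp t) 0 (clamp t) (source f ^~ r).
  apply: kernel_int_ge0; first exact: ltW.
  by move=> s _; case/andP: (source_bounds s af r0).
have : kernel_int r (clamp t) 0 (clamp t) (source f ^~ r) <=
    M * K * (1 - expR (- (r * clamp t))).
  apply: le_trans (kernel_int_le (C := M * K) _ _ _ _ _) _ => //.
  - exact: ltW.
  - exact: continuous_source.
  - by move=> s _; case/andP: (source_bounds s af r0).
  - by rewrite subrr subr0 mulr0 oppr0 expR0.
have e0 := expR_ge0 (- (r * clamp t)).
have e1 : expR (- (r * clamp t)) <= 1.
  by rewrite -expR0 ler_expR oppr_le0 mulr_ge0 // ltW.
have MK0 : 0 <= M * K by rewrite mulr_ge0 ?M_ge0 ?K_ge0.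
move: (kernel_int _ _ _ _ _) (expR _) (M * K) thetaK k0 e0 e1 MK0 => k e C thetaC.
by have := theta0; nra.
Qed.

Lemma riccati_admissible f : admissible f -> admissible (riccati f).
Proof.
move=> af; split; first by move=> t r; exact: riccati_bounds.
- move=> r r0 t; apply/cvgrPdist_le => e e0.
  (* The added 1 keeps the divisor positive when K = 0, that is, when theta = 0. *)
  have Kr : 0 < K * r + 1 by rewrite ltr_wpDl // mulr_ge0 ?K_ge0 // ltW.
  near=> s.
  apply: le_trans (riccati_lipschitz _ _ af r0) _.
  have : `|t - s| <= e / (K * r + 1).
    near: s; apply: (@cvgr_dist_le _ _ _ _ _ (fun s => s) t cvg_id).
    by rewrite divr_gt0.
  rewrite ler_pdivlMr // mulrDr mulr1 mulrC => h.
  by apply: le_trans h; rewrite lerDl.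
- move=> t r r0; have /andP[t0 _] := clamp_bounds t; apply: cvgD.
    apply: cvgMl_tmp.
    apply: (continuous_comp (f := fun r => - (r * clamp t))); last exact: continuous_expR.
    by apply: cvgN; apply: cvgMr_tmp; exact: cvg_id.
  apply: (@kernel_int_continuous_rate _ (source f) (clamp t) (M * K)) => //.
  + by move=> u u0; exact: continuous_source.
  + by move=> s u u0; exact: continuous_source_rate.
  + by move=> s u u0; exact: source_bounds.
Unshelve. all: by end_near. Qed.

(** * Picard iterates, their limit, and properties of fixpoints *)

Definition picard n : R -> R -> R := iter n riccati (fun _ _ => 0).

Lemma picard_admissible n : admissible (picard n).
Proof.
elim: n => [|n IH]; last exact: riccati_admissible.
by split => [t r _|r _ t|t r _]; [rewrite lexx K_ge0|exact: cvg_cst|exact: cvg_cst].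
Qed.

Lemma admissible_dist f g t r : admissible f -> admissible g -> 0 < r ->
  `|f t r - g t r| <= K.
Proof.
move=> [bf _ _] [bg _ _] r0; have := bf t r r0; have := bg t r r0.
move=> /andP[? ?] /andP[? ?]; rewrite ler_norml; apply/andP; split; lra.
Qed.

(** Contracting n times starts from the crude bound K between two admissible functions; the bound
    does not depend on m, so the iterates are uniformly Cauchy. *)
Lemma picard_dist m n t r : 0 < r ->
  `|picard (n + m) t r - picard n t r| <= M ^+ n * K.
Proof.
elim: n t r => [|n IH] t r r0.
  by rewrite expr0 mul1r; apply: admissible_dist => //; exact: picard_admissible.
rewrite addSn exprS -mulrA; apply: riccati_dist => //; try exact: picard_admissible.
by rewrite mulr_ge0 ?exprn_ge0 ?M_ge0 ?K_ge0.
Qed.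

Definition picard_limit t r : R := limn (fun n => picard n t r).

Lemma cvg_geometric_MK : (fun n => M ^+ n * K) @ \oo --> (0 : R).
Proof.
have /andP[M0 M1] := M01; rewrite -(mul0r K); apply: cvgMr_tmp.
by apply: cvg_expr; rewrite ger0_norm.
Qed.

Lemma picard_cvg t r : 0 < r -> picard n t r @[n --> \oo] --> picard_limit t r.
Proof.
move=> r0; apply/cauchy_cvgP/cauchy_exP => e e0.
have [n _ Hn] := (@cvgrPdist_lt _ _ _ _ _ _ _).1 cvg_geometric_MK _ e0.
exists (picard n t r), n => //= k /subnKC <-.
rewrite /ball /= distrC; apply: le_lt_trans (picard_dist _ _ _ r0) _.
have := Hn n (leqnn n); rewrite sub0r normrN; exact: le_lt_trans (ler_norm _).
Qed.

(** Let m tend to infinity in [picard_dist], with n fixed. *)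
Lemma picard_limit_dist n t r : 0 < r -> `|picard_limit t r - picard n t r| <= M ^+ n * K.
Proof.
move=> r0.
have h : `|picard (n + m) t r - picard n t r| @[m --> \oo] -->
    `|picard_limit t r - picard n t r|.
  apply: cvg_norm; apply: cvgB; last exact: cvg_cst.
  rewrite (_ : (fun m => _) = (fun m => picard (m + n) t r)); last first.
    by apply/funext => m; rewrite addnC.
  by have := @picard_cvg t r r0; rewrite -(cvg_shiftn n (fun k => picard k t r)).
rewrite -(cvg_lim _ h) //; apply: limr_le; first by apply/cvg_ex; eexists; exact: h.
by apply: nearW => m; exact: picard_dist.
Qed.

Lemma picard_limit_admissible : admissible picard_limit.
Proof.
have small e : 0 < e -> exists n, M ^+ n * K <= e.
  move=> e0; have [n _ Hn] := (@cvgrPdist_lt _ _ _ _ _ _ _).1 cvg_geometric_MK _ e0.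
  exists n; have := Hn n (leqnn n); rewrite sub0r normrN => /ltW.
  exact: le_trans (ler_norm _).
split.
- move=> t r r0; have cl := @picard_cvg t r r0.
  have b n : 0 <= picard n t r <= K by have [bp _ _] := picard_admissible n; exact: bp.
  have cv : cvgn (fun n => picard n t r) by apply/cvg_ex; eexists; exact: cl.
  apply/andP; split.
    by apply: limr_ge => //; apply: nearW => n; case/andP: (b n).
  by apply: limr_le => //; apply: nearW => n; case/andP: (b n).
- move=> r r0 t; apply: uniform_limit_continuous_at => e /small[n ne].
  exists (picard n ^~ r); split; first by have [_ c _] := picard_admissible n; exact: c.
  by near=> s; apply: le_trans ne; exact: picard_limit_dist.
- move=> t r r0; apply: uniform_limit_continuous_at => e /small[n ne].
  exists (picard n t); split; first by have [_ _ c] := picard_admissible n; exact: c.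
  (* The uniform estimate needs a positive rate, which holds for all rates near r > 0. *)
  near=> s; apply: le_trans ne; apply: picard_limit_dist; near: s.
  exact: lt_nbhsr.
Unshelve. all: by end_near. Qed.

Lemma geometric_bound_eq0 (x : R) : (forall n, `|x| <= M ^+ n * K) -> x = 0.
Proof.
move=> h; apply/normr0_eq0/eqP; rewrite eq_le normr_ge0 andbT.
rewrite -(cvg_lim _ cvg_geometric_MK) //; apply: limr_ge.
  by apply/cvg_ex; eexists; exact: cvg_geometric_MK.
exact: nearW.
Qed.

(** The shifted iterates tend to [riccati picard_limit] by contraction and to [picard_limit] by the
    index shift; limits are unique. *)
Lemma riccati_picard_limit t r : 0 < r ->
  riccati picard_limit t r = picard_limit t r.
Proof.
move=> r0.
have h : (fun n => picard n.+1 t r) @ \oo --> riccati picard_limit t r.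
  apply/cvgrPdist_le => e e0.
  have [N _ HN] := (@cvgrPdist_le _ _ _ _ _ _ _).1 cvg_geometric_MK _ e0.
  exists N => // n /= Nn; have := HN n Nn; rewrite sub0r normrN => ne.
  apply: le_trans (le_trans (ler_norm _) ne).
  have := riccati_dist picard_limit_admissible (picard_admissible n) _
    (fun t r => @picard_limit_dist n t r) t r0.
  move/(_ (mulr_ge0 (exprn_ge0 _ M_ge0) K_ge0)) => h; apply: le_trans h _.
  have /andP[M0 /ltW M1] := M01.
  by rewrite ler_piMl // mulr_ge0 ?exprn_ge0 ?K_ge0.
apply: (cvg_unique _ h) => //.
by have := @picard_cvg t r r0; rewrite -(cvg_shiftS (fun n => picard n t r)).
Qed.

(** Each replacement of f and g by their images gains a factor M, so the difference is at most M^n K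
    for every n. *)
Lemma riccati_fixpoint_unique f g : admissible f -> admissible g ->
    (forall t r, 0 < r -> riccati f t r = f t r) ->
    (forall t r, 0 < r -> riccati g t r = g t r) ->
  forall t r, 0 < r -> f t r = g t r.
Proof.
move=> af ag ff gg t r r0; apply/eqP; rewrite -subr_eq0; apply/eqP.
apply: geometric_bound_eq0 => n; elim: n t r r0 => [|n IH] t r r0.
  by rewrite expr0 mul1r; exact: admissible_dist.
rewrite exprS -mulrA -ff // -gg //; apply: riccati_dist => //.
by rewrite mulr_ge0 ?exprn_ge0 ?M_ge0 ?K_ge0.
Qed.

(* A fixpoint is Lipschitz in time, locally uniformly in the rate. *)
Lemma riccati_fixpoint_continuous f t r : admissible f ->
    (forall t r, 0 < r -> riccati f t r = f t r) -> 0 < r ->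
  {for (t, r), continuous (fun x : R * R => f x.1 x.2)}.
Proof.
move=> af ff r0; have [_ _ cf] := af; apply/cvgrPdist_le => e e0.
have e2 : 0 < e / 2 by rewrite divr_gt0.
have L0 : 0 <= K * (r + 1) by rewrite mulr_ge0 ?K_ge0 // addr_ge0 // ltW.
have L1 : 0 < K * (r + 1) + 1 by rewrite ltr_wpDl.
have ct : (fst x : R) @[x --> ((t, r) : R * R)] --> t by exact: cvg_fst.
have cr : (snd x : R) @[x --> ((t, r) : R * R)] --> r by exact: cvg_snd.
have ctr : f t x.2 @[x --> ((t, r) : R * R)] --> f t r by apply: cvg_comp cr (cf t r r0).
have nt := (cvgrPdist_le _ _).1 ct _ (divr_gt0 e2 L1).
have nr := (cvgrPdist_le _ _).1 ctr _ e2.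
near=> x.
have x0 : 0 < x.2 by near: x; apply: (cvgr_gt r).
have x1 : x.2 <= r + 1 by near: x; apply: (cvgr_le r) => //; rewrite ltrDl.
have ht : `|t - x.1| <= e / 2 / (K * (r + 1) + 1).
  by near: x; exact: nt.
have hr : `|f t r - f t x.2| <= e / 2 by near: x; exact: nr.
(* First the rate moves at the fixed time t, by separate continuity; then time moves at the rate
   [x.2] <= r + 1, with Lipschitz constant at most K (r + 1). *)
have -> : f t r - f x.1 x.2 = (f t r - f t x.2) + (f t x.2 - f x.1 x.2) by ring.
apply: le_trans (ler_normD _ _) _; rewrite [leRHS]splitr lerD //.
rewrite -ff // -[X in _ - X]ff //; apply: le_trans (riccati_lipschitz _ _ af x0) _.
move: ht; rewrite ler_pdivlMr // mulrC; apply: le_trans.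
rewrite ler_wpM2r // ler_wpDr // ler_wpM2l ?K_ge0 //.
Unshelve. all: by end_near. Qed.

End riccati_operator.

(** Turns continuity relative to the closed time interval into plain continuity: the clamped time
    never leaves [0, T], even around its endpoints. *)
Lemma within_continuous_comp (R : realType) (X Y : topologicalType) (A : set Y)
    (phi : Y -> R) (h : X -> Y) (x : X) :
    {within A, continuous phi} -> {for x, continuous h} ->
    (\forall y \near x, A (h y)) ->
  {for x, continuous (phi \o h)}.
Proof.
move=> /subspace_continuousP c ch nA.
apply: (cvg_comp _ _ _ (c (h x) (nbhs_singleton nA))) => B wB.
have nB : \forall y \near x, A (h y) -> B (h y) := ch _ wB.
by rewrite /= nbhs_simpl; near=> y; apply: (near nB y) => //; exact: (near nA y).
Unshelve. all: by end_near. Qed.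

(** * Mild solutions as fixpoints of the Riccati operator *)

Section mild_solutions.
Context (R : realType) (w theta T : R).
Context (rho : probability (measurableTypeR R) R).
Context (nu : {measure set (measurableTypeR R) -> \bar R}).
Hypothesis w01 : 0 <= w <= 1.
Hypothesis theta0 : 0 <= theta.
Hypothesis M01 : (0 < first_moment nu < 1)%E.
Hypothesis T0 : 0 < T.
Let M := fine (first_moment nu).
Let K := theta / (1 - M).

Let nu_fin : (first_moment nu < +oo)%E.
Proof. by have /andP[_ /lt_trans] := M01; apply; rewrite ltry. Qed.

Let fM01 : 0 <= M < 1.
Proof.
have /andP[M0 M1] := M01; have Mf : first_moment nu \is a fin_num.
  by rewrite ge0_fin_numE // ltW.
by rewrite /M -!lee_fin -lte_fin fineK // M1 ltW.
Qed.

Let thetaK : theta + M * K = K.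
Proof.
have /andP[_ M1] := fM01; have M1' : 1 - M != 0 by rewrite subr_eq0 gt_eqF.
by rewrite /K; field.
Qed.

Let psi_nu_ge0 : forall b, 0 <= psi nu b := psi_ge0 nu.
Let psi_nu0 : psi nu 0 = 0 := psi0 nu.
Let psi_nu_lip : forall b c, `|psi nu b - psi nu c| <= M * `|b - c| :=
  psi_lipschitz nu_fin.
Let T0' : 0 <= T := ltW T0.

Notation Phi := (riccati w theta T rho (psi nu)).
Notation adm := (admissible K).

(** Passage from extended-real to real integrals: nonnegative values give finite Laplace exponents
    equal to [psi], and all outer integrands are integrable. Agreement on the domain is enough
    because s <= t <= T. *)
Lemma mild_rhsE (f : R -> R -> R) (phi : R * R -> R) (t r : R) : adm f ->
    (forall s u, 0 <= s <= T -> 0 < u -> phi (s, u) = f s u) ->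
    0 <= t <= T -> 0 < r ->
  ((theta * expR (- (r * t)))%:E +
    \int[lebesgue_measure]_(s in `[0%R, t])
      ((expR (- (r * (t - s))) * r)%:E *
       (w%:E * laplace_exponent nu (phi (s, r)) +
        (1 - w)%:E * \int[rho]_(u in posR) laplace_exponent nu (phi (s, u)))) =
    (Phi f t r)%:E)%E.
Proof.
move=> af phif tT r0; have [bf _ _] := af.
rewrite /riccati clamp_id // [in RHS]EFinD; congr (_ + _)%E.
transitivity (\int[lebesgue_measure]_(s in `[0%R, t])
    (kernel r t s * source w rho (psi nu) f s r)%:E)%E.
  apply: eq_integral => s; rewrite inE /= in_itv /= => /andP[s0 st].
  have sT : 0 <= s <= T by rewrite s0 (le_trans st) //; case/andP: tT.
  rewrite phif // laplace_exponentE //; last by case/andP: (bf s r r0).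
  have -> : (\int[rho]_(u in posR) laplace_exponent nu (phi (s, u)) =
             (mean_Psi rho (psi nu) f s)%:E)%E.
    rewrite /mean_Psi /Rintegral fineK.
      apply: eq_integral => u; rewrite inE posRE => u0.
      by rewrite phif // laplace_exponentE //; case/andP: (bf s u u0).
    apply: integrable_fin_num; first exact: measurable_posR.
    exact: (integrable_Psi rho fM01 psi_nu_ge0 psi_nu0 psi_nu_lip s af).
  by [].
rewrite /kernel_int /Rintegral fineK //.
apply: integrable_fin_num => //; apply: kernel_integrable.
exact: (continuous_source theta0 fM01 thetaK psi_nu_ge0 psi_nu0 psi_nu_lip af r0).
Qed.

Lemma normT_leP (phi : R * R -> R) (C : R) :
  (normT T phi <= C%:E)%E <->
  (forall t r, 0 <= t <= T -> 0 < r -> `|phi (t, r)| <= C).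
Proof.
split => [nC t r tT r0|phiC].
  rewrite -lee_fin; apply: le_trans nC; apply: ereal_sup_ubound.
  by exists (t, r) => //; split; rewrite /= ?in_itv //= ?posRE.
apply: ge_ereal_sup => _ [[t r] [/= tT r0]] <-; rewrite lee_fin; apply: phiC.
  by move: tT; rewrite in_itv.
by move: r0; rewrite posRE.
Qed.

Lemma time_rate_domainE (t r : R) :
  time_rate_domain T (t, r) <-> 0 <= t <= T /\ 0 < r.
Proof. by rewrite /time_rate_domain /= posRE in_itv. Qed.

(** The norm bound in the uniqueness class supplies the upper bound K; joint continuity restricted
    to lines gives separate continuity. *)
Lemma solution_admissible (phi : R * R -> R) :
    bounded_nonneg_mild_solution w theta rho nu T phi ->
  adm (fun t r => phi (clamp T t, r)).
Proof.
move=> [[cphi _] phi0 _ /normT_leP phiK].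
split.
- move=> t r r0; rewrite phi0 /=; last by apply/time_rate_domainE; rewrite clamp_bounds.
  by apply: le_trans (ler_norm _) _; apply: phiK => //; exact: clamp_bounds.
- move=> r r0 t.
  apply: (within_continuous_comp (h := fun t => (clamp T t, r)) cphi).
    apply: (@cvg_pair _ _ _ _ (nbhs (clamp T t)) (nbhs r)); last exact: cvg_cst.
    exact: continuous_clamp.
  by near=> s; apply/time_rate_domainE; rewrite clamp_bounds.
- move=> t r r0.
  apply: (within_continuous_comp (h := fun r => (clamp T t, r)) cphi).
    apply: (@cvg_pair _ _ _ _ (nbhs (clamp T t)) (nbhs r)); last exact: cvg_id.
    exact: cvg_cst.
  near=> s; apply/time_rate_domainE; rewrite clamp_bounds //; split => //.
  by near: s; exact: lt_nbhsr.
Unshelve. all: by end_near. Qed.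

Lemma solution_fixpoint (phi : R * R -> R) (t r : R) :
    bounded_nonneg_mild_solution w theta rho nu T phi -> 0 < r ->
  Phi (fun t r => phi (clamp T t, r)) t r = phi (clamp T t, r).
Proof.
move=> sphi r0; have af := solution_admissible sphi; have [_ _ mphi _] := sphi.
(* The operator sees t only through its clamped value, so the mild equation at that time settles
   every real t. *)
have cc : clamp T (clamp T t) = clamp T t by rewrite clamp_id ?clamp_bounds.
apply: EFin_inj; rewrite [RHS]mphi ?clamp_bounds //.
rewrite (mild_rhsE af) ?clamp_bounds // /riccati ?cc // => s u sT u0.
by rewrite clamp_id.
Qed.

Notation limit := (picard_limit w theta T rho (psi nu)).

Let limit_admissible : adm limit :=
  picard_limit_admissible rho w01 theta0 fM01 thetaK T0' psi_nu_ge0 psi_nu0 psi_nu_lip.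

Let limit_fixpoint (t r : R) : 0 < r -> Phi limit t r = limit t r.
Proof.
exact: (riccati_picard_limit rho w01 theta0 fM01 thetaK T0' psi_nu_ge0 psi_nu0
  psi_nu_lip).
Qed.

Lemma picard_limit_solution :
  bounded_nonneg_mild_solution w theta rho nu T (fun x => limit x.1 x.2).
Proof.
have al := limit_admissible; have fl := limit_fixpoint.
have [bl _ _] := al.
have lK : (normT T (fun x => limit x.1 x.2) <= K%:E)%E.
  by apply/normT_leP => t r _ r0; have /andP[l0 lK] := bl t r r0; rewrite ger0_norm.
split => //.
- split; last by rewrite (le_lt_trans lK) // ltry.
  apply: continuous_in_subspaceT => -[t r]; rewrite inE => /time_rate_domainE[_ r0].
  exact: (riccati_fixpoint_continuous w01 theta0 fM01 thetaK T0' psi_nu_ge0 psi_nu0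
    psi_nu_lip al fl r0).
- by move=> [t r] /time_rate_domainE[_ r0]; case/andP: (bl t r r0).
- move=> t r tT r0; apply: etrans (congr1 EFin (esym (fl t r r0))) _.
  by apply/esym/(mild_rhsE (phi := fun x => limit x.1 x.2) al).
Qed.

Lemma solution_unique (phi : R * R -> R) (t r : R) :
    bounded_nonneg_mild_solution w theta rho nu T phi ->
    0 <= t <= T -> 0 < r ->
  phi (t, r) = limit t r.
Proof.
move=> sphi tT r0; rewrite -[in LHS](clamp_id tT).
exact: (riccati_fixpoint_unique w01 theta0 fM01 thetaK T0' psi_nu_ge0 psi_nu0
  psi_nu_lip (solution_admissible sphi) limit_admissible
  (fun t r => @solution_fixpoint phi t r sphi) limit_fixpoint).
Qed.

End mild_solutions.

Theorem proposition3 (R : realType) (w theta : R)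
    (rho : probability (measurableTypeR R) R)
    (nu : {measure set (measurableTypeR R) -> \bar R})
    (hw : 0 <= w <= 1) (htheta : 0 <= theta)
    (hrho_pos : on_positive_reals rho)
    (hrho_density : has_positive_density rho)
    (hnu : subordinator_levy_measure nu)
    (hM1 : (0 < first_moment nu < 1)%E)
    (T : R) (hT : 0 < T) :
  exists B : R * R -> R,
    bounded_nonneg_mild_solution w theta rho nu T B /\
    (forall B' : R * R -> R,
       bounded_nonneg_mild_solution w theta rho nu T B' ->
       {in time_rate_domain T, B' =1 B}).
Proof.
exists (fun x => picard_limit w theta T rho (psi nu) x.1 x.2); split.
  exact: picard_limit_solution.
move=> B' sB' [t r]; rewrite inE => /time_rate_domainE[tT r0].
exact: (solution_unique hw htheta hM1 hT sB').
Qed.
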